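(* Let $\mathcal{M} \in \mathsf{Mat}_{m}(\mathbb{F}_{q})$ be superregular, let $C \in \mathsf{Mat}_{n}(\mathbb{F}_{q})$ be the companion matrix of an $n$-degree primitive polynomial $p(x)\in \mathbb{F}_q [x]$, let $\alpha \in \mathbb{F}_{q^n}$ be a root of $p(x)$, and let $M=\Psi^{-1}(\mathcal{M} \otimes C)=[m_{i,k}] \in \mathsf{Mat}_{m}(\mathbb{F}_{q^n})$, which is a superregular matrix. Let $t$ and $j\le m$ be positive integers, let $n_{i,k}\in\mathbb{F}_q$ for $1\le i\le j$, $1\le k\le m$, and let $$N= \left(\begin{array}{cccc} m_{1,1} + n_{1,1}\alpha^t & m_{1,2} + n_{1,2}\alpha^t & \ldots & m_{1,m}+ n_{1,m}\alpha^t \\ m_{2,1} + n_{2,1}\alpha^t & m_{2,2} + n_{2,2}\alpha^t & \ldots & m_{2,m}+ n_{2,m}\alpha^t \\ \vdots & \vdots & \ddots & \vdots \\ m_{j,1} + n_{j,1}\alpha^t & m_{j,2} + n_{j,2}\alpha^t & \ldots & m_{j,m}+ n_{j,m}\alpha^t \\ m_{j+1,1} & m_{j+1,2} & \ldots & m_{j+1,m} \\ \vdots & \vdots & \ddots & \vdots \\ m_{m,1} & m_{m,2} & \ldots & m_{m,m} \end{array}\right)\in \mathsf{Mat}_{m}(\mathbb{F}_{q^n}).$$ Let $\omega\in S_m$ and let $N_\omega$ be the matrix obtained from $N$ by permuting its rows by $\omega$. If $t>1$, $j>1$ and $j(t-1)< n$, then the matrix $N$ is superregular over $\mathbb{F}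_{q^n}$.
   Context: $\mathbb{F}_q$ is the finite field with $q$ elements, $q$ a prime power. A matrix over a field is superregular if every square submatrix of it (of any size, obtained by choosing arbitrary rows and equally many arbitrary columns) is non-singular. $\mathsf{Mat}_m$ denotes $m\times m$ matrices. $A\otimes B$ is the Kronecker product, i.e. the block matrix whose $(i,k)$ block is $a_{ik}B$. A primitive polynomial of degree $n$ over $\mathbb{F}_q$ is the minimal polynomial over $\mathbb{F}_q$ of a primitive element (generator of the multiplicative group) of $\mathbb{F}_{q^n}$. Let $\langle C\rangle=\{O,I_n,C,C^2,\ldots,C^{q^n-2}\}=\mathbb{F}_q[C]$, which is a field. The map $\psi:\mathbb{F}_{q^n}\to\langle C\rangle$ with $\psi(\alpha)=C$ is the field isomorphism sending $\alpha^k$ to $C^k$ and $0$ to $O$ (so $a\in\mathbb{F}_q$ goes to $aI_n$). It is extended entrywise to matrices: $\Psi([a_{ik}])=[\psi(a_{ik})]$, a bijection from matrices over $\mathbb{F}_{q^n}$ onto matrices of the same size over $\langle C\rangle$. The matrix $\mathcal{M}\otimes C$, whose $n\times n$ blocks lie in $\langle C\rangle$, is viewed as an $m\times m$ matrix over $\langle C\rangle$. *)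

(* Defs.v *)
From HB Require Import structures.
From mathcomp Require Import all_boot all_order all_algebra all_field.
From mathcomp.real_closed Require Export mxtens.

Set Implicit Arguments.
Unset Strict Implicit.
Unset Printing Implicit Defensive.

Import GRing.Theory.
Local Open Scope ring_scope.

(* Strictly increasing f and g select k rows and k columns in their original
   order; the case k = 0 holds trivially. *)
Definition superregular (K : fieldType) (m1 m2 : nat) (A : 'M[K]_(m1, m2)) :=
  forall (k : nat) (f : 'I_k -> 'I_m1) (g : 'I_k -> 'I_m2),
    {homo f : x y / (x < y)%N} -> {homo g : x y / (x < y)%N} ->
    mxsub f g A \in unitmx.

(* For a field with two elements, 0 ^+ 0 = 1 would make 0 generate the nonzero
   elements, hence the first conjunct. *)
Definition primitive_element (K : fieldType) (z : K) :=
  z != 0 /\ forall x : K, x != 0 -> exists k : nat, x = z ^+ k.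

(* Primitive polynomials as minimal polynomials over F of primitive elements of
   L; qfpoly.primitive_poly describes them instead by irreducibility and the
   least n > 0 such that p divides 'X^n - 1. *)
Definition minPoly_of_primitive (F : fieldType) (L : fieldExtType F)
    (p : {poly F}) :=
  exists2 z : L, primitive_element z & map_poly (in_alg L) p = minPoly 1 z.

Arguments minPoly_of_primitive {F} L p.

Section Psi.

Variables (F : finFieldType) (L : fieldExtType F) (n : nat).
Variables (alpha : L) (C : 'M[F]_n).

(* When L has #|F| ^ n elements and alpha is a primitive element, the powers
   alpha ^+ k with k < #|F| ^ n - 1 enumerate the nonzero elements of L without
   repetition, so psi sends alpha ^+ k to C ^+ k, and the default case is
   reached only for 0. *)
Definition psi (x : L) : 'M[F]_n :=
  if [pick k : 'I_(#|F| ^ n).-1 | alpha ^+ k == x] is Some k then C ^+ k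
  else 0.

Definition Psi (m1 m2 : nat) (A : 'M[L]_(m1, m2)) : 'M['M[F]_n]_(m1, m2) :=
  map_mx psi A.

End Psi.

(* With the index convention of tensmx, block (i, k) of A *t B is A i k *: B. *)
Definition blocks (R : Type) (m1 m2 n1 n2 : nat) (A : 'M[R]_(m1 * n1, m2 * n2))
    : 'M['M[R]_(n1, n2)]_(m1, m2) :=
  \matrix_(i, k) \matrix_(a, b) A (mxtens_index (i, a)) (mxtens_index (k, b)).

(* insub (val i) is Some i' exactly when i < j, with i' : 'I_j of value i. *)
Definition perturb_rows (F : fieldType) (L : fieldExtType F) (m j : nat)
    (M : 'M[L]_m) (a : 'M[F]_(j, m)) (x : L) : 'M[L]_m :=
  \matrix_(i, k)
    if insub (val i) is Some i' then M i k + a i' k *: x else M i k.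

(* Main.v *)
Require Import Defs.
From mathcomp Require Import all_boot all_order all_algebra all_field.

Set Implicit Arguments.
Unset Strict Implicit.
Unset Printing Implicit Defensive.

Import GRing.Theory.
Local Open Scope ring_scope.

(** The element [alpha] is a conjugate of a primitive element, hence primitive
    ([conjugate_primitive]), so every nonzero element of [L] is one of the
    powers among which [psi] searches. The map [psi] sends a polynomial
    expression [r(alpha)] to [r(C)] ([psi_horner]): the irreducible polynomial
    [p] kills both [alpha] and the companion matrix [C], so a polynomial over
    [F] vanishes at either of them exactly when [p] divides it
    ([irreducible_kernel]). In particular [psi] is injective and sends
    [c *: alpha] to [c *: C], so the hypothesis on [M] says that [M] is
    [alpha *: MM], with [MM] read over [L].

    A square submatrix of [N] is therefore [alpha] times the value at [alpha]
    of a matrix [P] over [F[X]], with entries [MM i k + a i k * X ^ (t - 1)] in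
    the perturbed rows and the constants [MM i k] in the other rows. Its
    determinant [D] has constant term a minor of [MM], which is nonzero because
    [t - 1 > 0], and its degree is at most [t - 1] for each perturbed row, hence
    at most [j (t - 1) < n] ([perturbed_det_at0], [perturbed_det_size]).
    A nonzero polynomial of degree less than [n] is not divisible by [p], so [D]
    does not vanish at [alpha]. *)

(** * Evaluation at a root of an irreducible polynomial *)

(** If [p] did not divide [q], a Bezout relation between them would be mapped
    to [0 = 1]. The target is a general ring so that the lemma covers
    evaluation in a field and at a matrix alike. *)
Lemma irreducible_kernel (F : fieldType) (A : nzRingType)
    (phi : {rmorphism {poly F} -> A}) (p q : {poly F}) :
  irreducible_poly p -> phi p = 0 -> (phi q == 0) = (p %| q).
Proof.
move=> irr_p phi_p; apply/eqP/idP => [phi_q | /dvdpP[r ->]]; last first.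
  by rewrite rmorphM phi_p mulr0.
rewrite -[_ %| _]negbK -irreducible_poly_coprime //.
apply/negP => /Bezout_eq1_coprimepP[[u v] /= Euv].
have /eqP := congr1 phi Euv.
by rewrite rmorphD !rmorphM phi_p phi_q !mulr0 addr0 rmorph1 eq_sym oner_eq0.
Qed.

Lemma irreducible_kernel_eq (F : fieldType) (A : nzRingType)
    (phi : {rmorphism {poly F} -> A}) (p q r : {poly F}) :
  irreducible_poly p -> phi p = 0 -> (phi q == phi r) = (p %| q - r).
Proof.
by move=> irr_p phi_p; rewrite -subr_eq0 -rmorphB (irreducible_kernel _ irr_p).
Qed.

Lemma minPoly_base_irreducible (F : fieldType) (L : fieldExtType F)
    (p : {poly F}) (z : L) :
  map_poly (in_alg L) p = minPoly 1 z -> irreducible_poly p.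
Proof.
move=> Ep; split=> [|q size_q q_dv_p].
  by rewrite -(size_map_poly (in_alg L)) Ep size_minPoly.
have: map_poly (in_alg L) q %| minPoly 1%AS z by rewrite -Ep dvdp_map.
have q_over : map_poly (in_alg L) q \is a polyOver 1%AS.
  by apply/polyOver1P; exists q.
case/(minPoly_irr q_over)/orP; first by rewrite -Ep eqp_map.
by rewrite -size_poly_eq1 size_map_poly (negPf size_q).
Qed.

Section Generator.

Variables (F : finFieldType) (L : fieldExtType F) (p : {poly F}) (alpha : L).
Hypotheses (irr_p : irreducible_poly p) (alpha_root : horner_alg alpha p = 0).
Hypothesis deg_p : (size p).-1 = \dim {:L}.

(** The polynomials vanishing at [alpha] are multiples of [p], so the degree of
    [alpha] is that of [p], which is the degree of the whole extension. *)
Lemma root_generates (x : L) : exists r : {poly F}, x = horner_alg alpha r.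
Proof.
have [s Es] : exists s, minPoly 1 alpha = map_poly (in_alg L) s.
  exact/polyOver1P/minPolyOver.
have p_dv_s : p %| s.
  rewrite -(irreducible_kernel s irr_p alpha_root).
  by have := minPolyxx 1%AS alpha; rewrite Es => /eqP.
have size_s : size s = (adjoin_degree 1 alpha).+1.
  by rewrite -size_minPoly Es size_map_poly.
have degE : (\dim {:L} <= adjoin_degree 1%AS alpha)%N.
  rewrite -deg_p -[leqRHS]/(_.+1.-1) -size_s.
  have s_neq0 : s != 0 by rewrite -size_poly_gt0 size_s.
  by rewrite -!subn1 leq_sub2r // dvdp_leq.
have fullE : <<1; alpha>>%VS = {:L}%VS.
  by apply/eqP; rewrite eqEdim subvf dim_Fadjoin dimv1 muln1.
have : x \in <<1%AS; alpha>>%VS by rewrite fullE memvf.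
by case/Fadjoin_polyP => r /polyOver1P[s' ->] ->; exists s'.
Qed.

(** Conjugate elements satisfy the same polynomial relations over [F], and
    being a power of the generator is such a relation. *)
Lemma conjugate_primitive (z : L) :
  horner_alg z p = 0 -> primitive_element z -> primitive_element alpha.
Proof.
move=> z_root [z_neq0 z_gen].
have conj (r s : {poly F}) :
    (horner_alg alpha r == horner_alg alpha s) =
    (horner_alg z r == horner_alg z s).
  by rewrite !(irreducible_kernel_eq _ _ irr_p).
split=> [|x].
  have := conj 'X 0; rewrite !rmorph0 !horner_algX => ->; exact: z_neq0.
have [r ->] := root_generates x.
have := conj r 0; rewrite !rmorph0 => -> /z_gen[k rz].
by exists k; apply/eqP; rewrite -{2}(horner_algX alpha) -rmorphXn conj
  rmorphXn /= horner_algX; apply/eqP.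
Qed.

Hypothesis alpha_prim : primitive_element alpha.

(** Fermat's little theorem in [L] makes the exponents periodic, which brings
    an arbitrary one into the range where [psi] looks for it. *)
Lemma primitive_small_power (x : L) :
  x != 0 -> exists k : 'I_(#|F| ^ \dim {:L}).-1, alpha ^+ k = x.
Proof.
case: alpha_prim => alpha_neq0 gen /gen[k ->].
have q_gt1 : (1 < #|F| ^ \dim {:L})%N.
  by rewrite -[1%N](expn0 #|F|) ltn_exp2l ?finNzRing_gt1 // adim_gt0.
set e := (_ ^ _).-1.
have e_gt0 : (0 < e)%N by rewrite /e -ltnS (ltn_predK q_gt1).
have alpha_e : alpha ^+ e = 1.
  apply: (mulfI alpha_neq0); rewrite -exprS (ltn_predK q_gt1) mulr1.
  by apply/eqP; rewrite -Fermat's_little_theorem memvf.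
exists (Ordinal (ltn_pmod k e_gt0)) => /=.
by rewrite [in RHS](divn_eq k e) exprD mulnC exprM alpha_e expr1n mul1r.
Qed.

(** * The isomorphism psi *)

Variables (n' : nat) (C : 'M[F]_n'.+1).
Hypotheses (dimL : \dim {:L} = n'.+1) (C_root : horner_mx C p = 0).

(** [psi] searches for an exponent, but any polynomial expression in [alpha]
    would give the same value at [C]. This form makes [psi] computable on sums
    and scalar multiples, where the exponent is out of reach. *)
Lemma psi_horner (r : {poly F}) :
  psi alpha C (horner_alg alpha r) = horner_mx C r.
Proof.
have transfer s :
    (horner_alg alpha s == horner_alg alpha r) =
    (horner_mx C s == horner_mx C r).
  by rewrite !(irreducible_kernel_eq _ _ irr_p).
rewrite /psi; case: pickP => [k /= | no_k].
  rewrite -{1}(horner_algX alpha) -rmorphXn transfer rmorphXn /= horner_mx_X.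
  by move/eqP.
have [r0 | /primitive_small_power] := eqVneq (horner_alg alpha r) 0.
  by have := transfer 0; rewrite r0 !rmorph0 eqxx => /esym/eqP.
by rewrite dimL => -[k Ek]; have := no_k k; rewrite Ek eqxx.
Qed.

Lemma psi_inj : injective (psi alpha C).
Proof.
move=> x y; have [r ->] := root_generates x; have [s ->] := root_generates y.
rewrite !psi_horner => /eqP rsC; apply/eqP; move: rsC.
by rewrite !(irreducible_kernel_eq _ _ irr_p).
Qed.

Lemma psi_scale (c : F) : psi alpha C (c *: alpha) = c *: C.
Proof.
have -> : c *: alpha = horner_alg alpha (c *: 'X).
  by rewrite linearZ /= horner_algX mulr_algl.
by rewrite psi_horner linearZ /= horner_mx_X.
Qed.

End Generator.

(** * The determinant of the perturbed submatrix *)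

Lemma size_det_leq (R : comNzRingType) (k : nat) (P : 'M[{poly R}]_k)
    (d : 'I_k -> nat) :
  (forall i l, size (P i l) <= (d i).+1)%N ->
  (size (\det P) <= (\sum_i d i).+1)%N.
Proof.
move=> size_P; rewrite /determinant; apply: (leq_trans (size_sum _ _ _)).
apply/bigmax_leqP => s _.
rewrite -[_ ^+ _](rmorph_sign (polyC : {rmorphism R -> {poly R}})) mul_polyC.
apply: (leq_trans (size_scale_leq _ _)).
apply: (leq_trans (size_poly_prod_leq _ _)).
rewrite leq_subLR addnS ltnS -[#|_|]sum1_card -big_split /=.
by apply: leq_sum => i _; rewrite add1n.
Qed.

Lemma inj_count_ltn (k m j : nat) (f : 'I_k -> 'I_m) :
  injective f -> (\sum_i (f i < j)%N <= j)%N.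
Proof.
move=> f_inj; rewrite -big_mkcond sum1_card /=.
pose h (i : 'I_k) : nat := f i.
have h_inj : injective h by exact: inj_comp val_inj f_inj.
rewrite cardE -(size_map h) -[leqRHS](size_iota 0).
apply: uniq_leq_size; first by rewrite (map_inj_uniq h_inj) enum_uniq.
by move=> _ /mapP[i + ->]; rewrite mem_enum mem_iota.
Qed.

Section PerturbedMinor.

Variables (F : fieldType) (k m j t : nat) (A E : 'M[F]_(k, k)).
Variable f : 'I_k -> 'I_m.
Hypothesis f_inj : injective f.
Hypothesis E_rows : forall i l, (j <= f i)%N -> E i l = 0.

Let P : 'M[{poly F}]_k := \matrix_(i, l) ((A i l)%:P + E i l *: 'X^t).

(** Only the rows that [f] takes among the first [j] can contribute to the
    degree, and as [f] is injective there are at most [j] of them. *)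
Lemma perturbed_det_size : (size (\det P) <= (j * t).+1)%N.
Proof.
apply: (leq_trans (@size_det_leq _ _ P (fun i => (f i < j) * t)%N _)).
  move=> i l; rewrite mxE; apply: (leq_trans (size_polyD _ _)).
  rewrite geq_max (leq_trans (size_polyC_leq1 _)) //=.
  case: ltnP => fi; last by rewrite E_rows // scale0r size_poly0.
  by rewrite mul1n (leq_trans (size_scale_leq _ _)) // size_polyXn.
by rewrite ltnS -big_distrl /= leq_mul2r inj_count_ltn ?orbT.
Qed.

Lemma perturbed_det_at0 : (0 < t)%N -> (\det P).[0] = \det A.
Proof.
move=> t_gt0; rewrite -[_.[0]]/(horner_eval 0 (\det P)) -det_map_mx.
congr (\det _); apply/matrixP => i l; rewrite !mxE /= /horner_eval !hornerE.
by rewrite expr0n (gtn_eqF t_gt0) mulr0 addr0.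
Qed.

End PerturbedMinor.

(** * Superregularity *)

Theorem theorem9 (F : finFieldType) (n : nat) (L : fieldExtType F)
    (dimL : \dim {:L} = n)
    (m : nat) (MM : 'M[F]_m) (MM_superregular : superregular MM)
    (p : {poly F}) (degp : (size p).-1 = n) (p_primitive : minPoly_of_primitive L p)
    (C : 'M[F]_n) (defC : C = castmx (degp, degp) (companionmx p))
    (alpha : L) (alpha_root : root (map_poly (in_alg L) p) alpha)
    (M : 'M[L]_m) (defM : Psi alpha C M = blocks (tensmx MM C))
    (t j : nat) (a : 'M[F]_(j, m)) (j_le_m : (j <= m)%N)
    (t_gt1 : (1 < t)%N) (j_gt1 : (1 < j)%N) (jt_lt_n : (j * (t - 1) < n)%N) :
  superregular (perturb_rows M a (alpha ^+ t)).
Proof.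
have [z z_prim Ep] := p_primitive.
have irr_p := minPoly_base_irreducible Ep.
have p_monic : p \is monic by rewrite -(map_monic (in_alg L)) Ep monic_minPoly.
have alpha_p : horner_alg alpha p = 0 by exact/rootP.
have z_p : horner_alg z p = 0.
  by have := minPolyxx 1%AS z; rewrite -Ep.
have degL : (size p).-1 = \dim {:L} by rewrite dimL.
have alpha_prim := conjugate_primitive irr_p alpha_p degL z_p z_prim.
have char_C : char_poly C = p.
  rewrite defC -[RHS](companionmxK p_monic).
  by case: n / degp {dimL C defC defM jt_lt_n}; rewrite castmx_id.
have M_scale i l : M i l = MM i l *: alpha.
  case: n dimL {degp defC} C char_C defM jt_lt_n => // n' dimL' C' char_C defM _.
  have C_root : horner_mx C' p = 0 by rewrite -char_C Cayley_Hamilton.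
  apply: (psi_inj irr_p alpha_p degL alpha_prim dimL' C_root).
  rewrite (psi_scale irr_p alpha_p alpha_prim dimL' C_root).
  have /matrixP/(_ i l) := defM; rewrite !mxE => ->.
  by apply/matrixP => b c; rewrite !mxE !mxtens_indexK.
move=> k f g f_mono g_mono.
pose A := mxsub f g MM.
pose E : 'M[F]_k :=
  \matrix_(i, l) if insub (val (f i)) is Some i' then a i' (g l) else 0.
pose P : 'M[{poly F}]_k := \matrix_(i, l) ((A i l)%:P + E i l *: 'X^(t - 1)).
have f_inj : injective f.
  by move=> x y fxy; case: (ltngtP x y) => [/f_mono|/f_mono|/val_inj //];
    rewrite fxy ltnn.
have E_rows i l : (j <= f i)%N -> E i l = 0.
  by move=> fi; rewrite mxE insubF // ltnNge fi.
have -> : mxsub f g (perturb_rows M a (alpha ^+ t)) =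
          alpha *: map_mx (horner_alg alpha) P.
  apply/matrixP => i l; rewrite !mxE rmorphD /= horner_algC linearZ /=.
  rewrite rmorphXn /= horner_algX M_scale mulrDr mulr_algr mulr_algl.
  rewrite -scalerAr -exprS subn1 (ltn_predK t_gt1).
  by case: insub => [i'|] //; rewrite scale0r addr0.
have alpha_neq0 : alpha != 0 by case: alpha_prim.
rewrite unitmxE unitfE detZ det_map_mx mulf_neq0 ?expf_neq0 //=.
rewrite (irreducible_kernel _ irr_p alpha_p).
have detP0 : \det P != 0.
  have := MM_superregular k f g f_mono g_mono.
  rewrite unitmxE unitfE; apply: contraNneq => detP.
  by rewrite -(perturbed_det_at0 A E (t := t - 1)) ?subn_gt0 // -/P detP horner0.
apply/negP => /(dvdp_leq detP0); apply/negP; rewrite -ltnNge.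
apply: (leq_ltn_trans (perturbed_det_size (t - 1) A f_inj E_rows)).
by rewrite -ltn_predRL degp.
Qed.
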